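(* Let $\mathcal{M}:(0,\infty)\to(0,\infty)$ be the Mina margin map. Then: (1) $\mathcal{M}(s(x))=\mathcal{M}(x)$ for all $x\in(0,\infty)$; (2) $\mathcal{M}$ is continuous on $(0,\infty)$ and $\mathcal{M}(x)=\Big(\sum_{k\in\mathbb{Z}}\prod_{i=0}^k(c_i(x)-1)\Big)^{-1}\cdot x\sum_{k\in\mathbb{Z}}\prod_{i=0}^k(d_i(x)-1)$; (3) $\mathcal{M}((0,\infty))=[\lambda,\lambda^{-1}]$ for some $\lambda\in(0,0.999904]$ (this $\lambda$ is the infimum of Mina margins of positive ABMN solutions).
   Context: ABMN system on $\mathbb{Z}$: real variables $a_i,b_i\ge0$, $m_i,n_i$ with, for all $i$, $(a_i+b_i)(m_i+a_i)=a_im_{i+1}+b_im_{i-1}$, $(a_i+b_i)(n_i+b_i)=a_in_{i+1}+b_in_{i-1}$, $(a_i+b_i)^2=b_i(m_{i+1}-m_{i-1})$, $(a_i+b_i)^2=a_i(n_{i-1}-n_{i+1})$; positive if all $a_i,b_i>0$; $m_{\pm\infty},n_{\pm\infty}$ are the (real) limits as $i\to\pm\infty$; the Mina margin is $\frac{n_{-\infty}-n_\infty}{m_\infty-m_{-\infty}}$; the central ratio is $\frac{n_{-1}-n_0}{m_0-m_{-1}}$. A positive solution is standard if $m_{-\infty}=0$, $n_\infty=0$, $m_\infty=1$; for each $x>0$ there is exactly one standard solution $(a^{\rm st}(x),b^{\rm st}(x),m^{\rm st}(x),n^{\rm st}(x))$ with central ratio $x$. The Mina margin map is $\mathcal{M}(x)=n^{\rm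 st}_{-\infty}(x)$, the Mina margin of that solution. Functions: for $x>0$, $\omega=\sqrt{8x+1}$, $c(x)=\frac{(\omega+3)^2}{16}$, $d(x)=\frac{(\omega+3)^2}{8(\omega+1)}$, $s(x)=\frac{(\omega-1)^2}{4(\omega+7)}$; $s_{-1}(x)=1/s(1/x)$, $s_0(x)=x$, $s_i=s\circ s_{i-1}$, $s_{-i}=s_{-1}\circ s_{-(i-1)}$ ($i\in\mathbb{N}_+$); $c_j=c\circ s_j$, $d_j=d\circ s_j$. Product convention: $\prod_{i=0}^k h_i=h_0\cdots h_k$ for $k\ge0$, $=1$ for $k=-1$, $=h_{k+1}^{-1}\cdots h_{-1}^{-1}$ for $k\le-2$. *)

(* Defs.v *)
From Stdlib Require Import Reals ZArith ClassicalEpsilon.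
Open Scope R_scope.

Definition ABMN (a b m n : Z -> R) : Prop :=
  forall i : Z,
    0 <= a i /\ 0 <= b i /\
    (a i + b i) * (m i + a i) = a i * m (i + 1)%Z + b i * m (i - 1)%Z /\
    (a i + b i) * (n i + b i) = a i * n (i + 1)%Z + b i * n (i - 1)%Z /\
    (a i + b i) ^ 2 = b i * (m (i + 1)%Z - m (i - 1)%Z) /\
    (a i + b i) ^ 2 = a i * (n (i - 1)%Z - n (i + 1)%Z).

Definition positive_ABMN (a b m n : Z -> R) : Prop :=
  ABMN a b m n /\ forall i : Z, 0 < a i /\ 0 < b i.

Definition lim_pinf (u : Z -> R) (l : R) : Prop :=
  Un_cv (fun k : nat => u (Z.of_nat k)) l.
Definition lim_minf (u : Z -> R) (l : R) : Prop :=
  Un_cv (fun k : nat => u (- Z.of_nat k)%Z) l.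

Definition mina_margin (mmi mpi nmi npi : R) : R := (nmi - npi) / (mpi - mmi).

Definition central_ratio (m n : Z -> R) : R :=
  (n (-1)%Z - n 0%Z) / (m 0%Z - m (-1)%Z).

Definition standard (a b m n : Z -> R) : Prop :=
  positive_ABMN a b m n /\ lim_minf m 0 /\ lim_pinf n 0 /\ lim_pinf m 1 /\
  exists l, lim_minf n l.

(* Mina margin map: n_{-oo} of the (unique) standard solution with central ratio x
   (its Mina margin equals n_{-oo}). *)
Definition MinaMap (x : R) : R :=
  epsilon (inhabits 0) (fun y => exists a b m n,
    standard a b m n /\ central_ratio m n = x /\ lim_minf n y).

Definition omega (x : R) : R := sqrt (8 * x + 1).
Definition cfun (x : R) : R := (omega x + 3) ^ 2 / 16.
Definition dfun (x : R) : R := (omega x + 3) ^ 2 / (8 * (omega x + 1)).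
Definition sfun (x : R) : R := (omega x - 1) ^ 2 / (4 * (omega x + 7)).
Definition sm1 (x : R) : R := / sfun (/ x).

Definition s_Z (j : Z) (x : R) : R :=
  match j with
  | Z0 => x
  | Zpos p => Nat.iter (Pos.to_nat p) sfun x
  | Zneg p => Nat.iter (Pos.to_nat p) sm1 x
  end.

Definition c_Z (j : Z) (x : R) : R := cfun (s_Z j x).
Definition d_Z (j : Z) (x : R) : R := dfun (s_Z j x).

Fixpoint prodn (f : nat -> R) (n : nat) : R :=
  match n with
  | O => 1
  | S k => prodn f k * f k
  end.

(* \prod_{i=0}^k h_i with the paper's convention for k <= -1 *)
Definition zprod (h : Z -> R) (k : Z) : R :=
  if Z.leb 0 k then prodn (fun i => h (Z.of_nat i)) (S (Z.to_nat k))
  else prodn (fun j => / h (- Z.of_nat j - 1)%Z) (Z.to_nat (- k - 1)).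

Definition zsum (f : Z -> R) (l : R) : Prop :=
  exists l1 l2,
    infinite_sum (fun k : nat => f (Z.of_nat k)) l1 /\
    infinite_sum (fun k : nat => f (- Z.of_nat k - 1)%Z) l2 /\
    l = l1 + l2.

Definition is_inf (S : R -> Prop) (l : R) : Prop :=
  (forall y, S y -> l <= y) /\ (forall l', (forall y, S y -> l' <= y) -> l' <= l).

Definition margins_of_positive : R -> Prop := fun r =>
  exists a b m n mmi mpi nmi npi,
    positive_ABMN a b m n /\ lim_minf m mmi /\ lim_pinf m mpi /\
    lim_minf n nmi /\ lim_pinf n npi /\ r = mina_margin mmi mpi nmi npi.

(* Main.v *)
Require Import Defs.
From Stdlib Require Import Reals ZArith ClassicalEpsilon Lra Lia Ranalysis5.
From Coquelicot Require Import Coquelicot.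
Open Scope R_scope.

(** Put [u_i = m_i - m_(i-1)], [v_i = n_(i-1) - n_i] and [t = b_i / a_i]. The four ABMN
    equations at [i] say exactly that [u_i = a_i^2 / b_i], [v_i = a_i + 2 b_i],
    [u_(i+1) = 2 a_i + b_i] and [v_(i+1) = b_i^2 / a_i]. Hence [x_i = v_i / u_i] equals
    [t (1 + 2 t)], which determines [t], and passing to [i + 1] maps [x_i] to [s(x_i)]
    and multiplies [u], [v] by [c(x_i) - 1], [d(x_i) - 1]. So a positive solution is
    given by its central ratio up to scaling and translations of [m] and [n], and its
    margin is the quotient of the series in (2).

    The reflection [i -> -1 - i], exchanging [a, b] and [m, n], inverts both the central
    ratio and the margin, and expresses the halves of the series at [-oo] through those
    at [+oo], which converge locally uniformly because [s(x) <= x / 9]. Invariance under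
    [s] and inversion reduces every value to [1/10, 10] (note [s(1) = 1/10]), so a minimum
    [lam] exists, [/ lam] is the maximum, and a numerical evaluation at [x = 0.58] bounds
    [lam]. *)

(** * Algebra of [s], [c - 1] and [d - 1] in the parameter [t = beta x] *)

(* The ratio [b_i / a_i] in terms of [x = v_i / u_i]. *)
Definition beta (x : R) : R := (omega x - 1) / 4.
Definition cm1 (x : R) : R := cfun x - 1.
Definition dm1 (x : R) : R := dfun x - 1.

Lemma omega_gt1 x : 0 < x -> 1 < omega x.
Proof.
  intros Hx; unfold omega; rewrite <- sqrt_1 at 1; apply sqrt_lt_1; lra.
Qed.

Lemma beta_pos x : 0 < x -> 0 < beta x.
Proof. intros Hx; unfold beta; generalize (omega_gt1 x Hx); lra. Qed.

Lemma beta_eq x : 0 < x -> beta x * (1 + 2 * beta x) = x.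
Proof.
  intros Hx; unfold beta, omega.
  assert (H := sqrt_sqrt (8 * x + 1) ltac:(lra)).
  nra.
Qed.

Lemma quad_le s t : 0 <= s -> 0 <= t -> s * (1 + 2 * s) <= t * (1 + 2 * t) -> s <= t.
Proof. intros; nra. Qed.

(** Parametrizing by [x = t * (1 + 2 * t)] removes the square root: in terms of [t], all the
    functions involved become rational. *)
Lemma beta_unique t : 0 < t -> beta (t * (1 + 2 * t)) = t.
Proof.
  intros Ht.
  assert (Hx : 0 < t * (1 + 2 * t)) by nra.
  pose proof (beta_eq _ Hx) as He; pose proof (beta_pos _ Hx) as Hp.
  apply Rle_antisym; apply quad_le; lra.
Qed.

Lemma sfun_beta x : 0 < x -> sfun x = beta x ^ 2 / (2 + beta x).
Proof.
  intros Hx; unfold sfun, beta; generalize (omega_gt1 x Hx); intros; field; lra.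
Qed.

Lemma cm1_beta x : cm1 x = beta x * (2 + beta x).
Proof. unfold cm1, cfun, beta; field. Qed.

Lemma dm1_beta x : 0 < x -> dm1 x = beta x ^ 2 / (1 + 2 * beta x).
Proof.
  intros Hx; unfold dm1, dfun, beta; generalize (omega_gt1 x Hx); intros; field; lra.
Qed.

Lemma sfun_pos x : 0 < x -> 0 < sfun x.
Proof.
  intros Hx; rewrite sfun_beta by easy; pose proof (beta_pos x Hx).
  apply Rdiv_lt_0_compat; nra.
Qed.

(** In terms of [t] the claim is [9 * t^2 <= t * (1 + 2*t) * (2 + t)], and the difference of the two
    sides is [2 * t * (t - 1)^2]. Equality holds at [t = 1], that is [x = 3]. *)
Lemma sfun_le x : 0 < x -> sfun x <= x / 9.
Proof.
  intros Hx; rewrite sfun_beta by easy; rewrite <- (beta_eq x Hx) at 3.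
  pose proof (beta_pos x Hx) as Hb; set (t := beta x) in *.
  apply Rmult_le_reg_r with (2 + t); [lra|].
  replace (t ^ 2 / (2 + t) * (2 + t)) with (t ^ 2) by (field; lra).
  assert (0 <= (t - 1) ^ 2) by apply pow2_ge_0. nra.
Qed.

Lemma beta_le x : 0 < x -> beta x <= x.
Proof. intros Hx; pose proof (beta_pos x Hx); pose proof (beta_eq x Hx); nra. Qed.

(** [/ sfun x = (2 + t) / t^2 = (/ t) * (1 + 2 / t)], so its parameter is [/ t]. *)
Lemma beta_inv_sfun x : 0 < x -> beta (/ sfun x) = / beta x.
Proof.
  intros Hx; pose proof (beta_pos x Hx) as Hb.
  rewrite <- (beta_unique (/ beta x)) by (apply Rinv_0_lt_compat; easy).
  f_equal; rewrite sfun_beta by easy; field; lra.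
Qed.

(** The map [x -> / sfun x] is thus an involution, which makes [sm1] the inverse of [sfun]. *)
Lemma sfun_inv_sfun x : 0 < x -> sfun (/ sfun x) = / x.
Proof.
  intros Hx; pose proof (beta_pos x Hx) as Hb.
  rewrite sfun_beta by (apply Rinv_0_lt_compat, sfun_pos; easy).
  rewrite beta_inv_sfun by easy; rewrite <- (beta_eq x Hx) at 3; field; lra.
Qed.

(** Substituting [/ t] for [t] exchanges the two weights up to reciprocals; this turns backward
    products into forward ones. *)
Lemma cm1_inv_sfun x : 0 < x -> / cm1 (/ sfun x) = dm1 x.
Proof.
  intros Hx; pose proof (beta_pos x Hx) as Hb.
  rewrite cm1_beta, dm1_beta, beta_inv_sfun by easy; field; lra.
Qed.

Lemma dm1_inv_sfun x : 0 < x -> / dm1 (/ sfun x) = cm1 x.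
Proof.
  intros Hx; pose proof (beta_pos x Hx) as Hb.
  rewrite cm1_beta, dm1_beta, beta_inv_sfun by
    (easy || apply Rinv_0_lt_compat, sfun_pos; easy).
  field; lra.
Qed.

Lemma sm1_pos x : 0 < x -> 0 < sm1 x.
Proof. intros; apply Rinv_0_lt_compat, sfun_pos, Rinv_0_lt_compat; easy. Qed.

Lemma sfun_sm1 x : 0 < x -> sfun (sm1 x) = x.
Proof.
  intros Hx; unfold sm1; rewrite sfun_inv_sfun by (apply Rinv_0_lt_compat; easy).
  apply Rinv_inv.
Qed.

(** * Weights: growth bound and continuity *)

(** Isolates what convergence and continuity of the series use, so that [cm1] and [dm1] are treated
    together. The bound tends to 0 at 0, the limit of every orbit of [sfun]. *)
Definition weight (h : R -> R) : Prop :=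
  (forall x, 0 < x -> 0 < h x <= x * (2 + x)) /\
  (forall x, 0 < x -> continuity_pt h x).

Lemma continuity_pt_ex_derive (f : R -> R) x : ex_derive f x -> continuity_pt f x.
Proof.
  intros H; apply continuity_pt_filterlim; apply (ex_derive_continuous f x H).
Qed.

Lemma sfun_continuity x : 0 < x -> continuity_pt sfun x.
Proof.
  intros Hx; apply continuity_pt_ex_derive; unfold sfun, omega.
  pose proof (omega_gt1 x Hx) as Ho; unfold omega in Ho.
  auto_derive; repeat split; lra.
Qed.

Lemma weight_cm1 : weight cm1.
Proof.
  split; intros x Hx.
  - rewrite cm1_beta; pose proof (beta_pos x Hx); pose proof (beta_le x Hx); nra.
  - apply continuity_pt_ex_derive; unfold cm1, cfun, omega.
    auto_derive; repeat split; lra.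
Qed.

Lemma dm1_pos x : 0 < x -> 0 < dm1 x.
Proof.
  intros Hx; rewrite dm1_beta by easy; pose proof (beta_pos x Hx).
  apply Rdiv_lt_0_compat; nra.
Qed.

Lemma cm1_pos x : 0 < x -> 0 < cm1 x.
Proof. apply weight_cm1. Qed.

Lemma weight_dm1 : weight dm1.
Proof.
  split; intros x Hx.
  - split; [now apply dm1_pos|].
    rewrite dm1_beta by easy; pose proof (beta_pos x Hx); pose proof (beta_le x Hx).
    apply Rmult_le_reg_r with (1 + 2 * beta x); [lra|].
    replace (beta x ^ 2 / (1 + 2 * beta x) * (1 + 2 * beta x)) with (beta x ^ 2)
      by (field; lra).
    apply Rle_trans with (x * (2 + x) * 1); nra.
  - apply continuity_pt_ex_derive; unfold dm1, dfun, omega.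
    pose proof (omega_gt1 x Hx) as Ho; unfold omega in Ho.
    auto_derive; repeat split; lra.
Qed.

(** * Series of products along forward orbits of [s] *)

Definition orbit_prod (h : R -> R) (x : R) (k : nat) : R :=
  prodn (fun i => h (Nat.iter i sfun x)) k.

(* Starts with the product of one factor: the empty product is not a summand. *)
Definition orbit_sum (h : R -> R) (x : R) : R :=
  Series (fun k => orbit_prod h x (S k)).

Lemma prodn_ext f g n : (forall i, f i = g i) -> prodn f n = prodn g n.
Proof. intros H; induction n as [|n IH]; simpl; [easy|now rewrite IH, H]. Qed.

Lemma prodn_shift f n : prodn f (S n) = f 0%nat * prodn (fun i => f (S i)) n.
Proof.
  induction n as [|n IH]; [simpl; ring|].
  change (prodn f (S (S n))) with (prodn f (S n) * f (S n)); rewrite IH; simpl; ring.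
Qed.

Lemma prodn_le f g n : (forall i, 0 <= f i <= g i) -> 0 <= prodn f n <= prodn g n.
Proof.
  intros H; induction n as [|n IH]; simpl; [lra|]; specialize (H n); nra.
Qed.

Lemma iter_sfun_pos x i : 0 < x -> 0 < Nat.iter i sfun x.
Proof. intros Hx; induction i as [|i IH]; simpl; [easy|now apply sfun_pos]. Qed.

Lemma iter_sfun_le x i : 0 < x -> Nat.iter i sfun x <= x / 9 ^ i.
Proof.
  intros Hx; induction i as [|i IH]; simpl; [lra|].
  pose proof (sfun_le _ (iter_sfun_pos x i Hx)).
  replace (x / (9 * 9 ^ i)) with (x / 9 ^ i / 9) by (field; apply pow_nonzero; lra).
  lra.
Qed.

Lemma orbit_prod_pos h x k : weight h -> 0 < x -> 0 < orbit_prod h x k.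
Proof.
  intros [Hh _] Hx; unfold orbit_prod; induction k as [|k IH]; simpl; [lra|].
  apply Rmult_lt_0_compat; [easy|]; apply Hh, iter_sfun_pos, Hx.
Qed.

Lemma orbit_prod_shift h x k : orbit_prod h x (S k) = h x * orbit_prod h (sfun x) k.
Proof.
  unfold orbit_prod; rewrite prodn_shift; f_equal; apply prodn_ext; intros i.
  f_equal; induction i as [|i IH]; simpl; [easy|now rewrite <- IH].
Qed.

(** Combines [h y <= y * (2 + y)] with [y <= X / 9^i] and [y <= X] at the [i]-th orbit point; it
    serves all starting points up to [X] at once. *)
Definition majorant (X : R) (k : nat) : R :=
  prodn (fun i => X * (2 + X) / 9 ^ i) (S k).

Lemma orbit_prod_le_majorant h X x k :
  weight h -> 0 < x <= X -> orbit_prod h x (S k) <= majorant X k.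
Proof.
  intros [Hh _] Hx; apply prodn_le; intros i.
  pose proof (iter_sfun_pos x i (proj1 Hx)) as Hp.
  pose proof (iter_sfun_le x i (proj1 Hx)) as Hl.
  specialize (Hh _ Hp).
  assert (H9 : 1 <= 9 ^ i) by (apply pow_R1_Rle; lra).
  assert (Hi : 0 < / 9 ^ i <= 1).
  { split; [apply Rinv_0_lt_compat; lra|].
    rewrite <- Rinv_1; apply Rinv_le_contravar; lra. }
  unfold Rdiv in *; set (w := / 9 ^ i) in *; set (y := Nat.iter i sfun x) in *.
  assert (y <= X * w) by nra; assert (y <= X) by nra.
  split; [lra|]; apply Rle_trans with (y * (2 + y)); [lra|].
  apply Rle_trans with (X * w * (2 + X)); [|lra]; apply Rmult_le_compat; lra.
Qed.

(** Ratio test: the quotient of consecutive terms is [X * (2 + X) / 9^(k+1)], which tends to 0. *)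
Lemma ex_series_majorant X : 0 < X -> ex_series (majorant X).
Proof.
  intros HX.
  assert (Hp : forall k, 0 < majorant X k).
  { intros k; unfold majorant; generalize (S k); intros n.
    induction n as [|n IH]; simpl; [lra|].
    apply Rmult_lt_0_compat; [easy|].
    apply Rdiv_lt_0_compat; [nra|apply pow_lt; lra]. }
  apply ex_series_ext with (fun k => Rabs (majorant X k)).
  { intros k; apply Rabs_pos_eq, Rlt_le, Hp. }
  apply ex_series_DAlembert with 0; [lra| |].
  { intros k; generalize (Hp k); lra. }
  apply is_lim_seq_ext with (fun n => X * (2 + X) / 9 * (/ 9) ^ n).
  { intros n; rewrite Rabs_pos_eq by (apply Rlt_le, Rdiv_lt_0_compat; apply Hp).
    change (majorant X (S n)) with (majorant X n * (X * (2 + X) / 9 ^ S n)).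
    rewrite pow_inv, <- tech_pow_Rmult; field; split; [|generalize (Hp n); lra].
    apply pow_nonzero; lra. }
  replace (Finite 0) with (Rbar_mult (X * (2 + X) / 9) 0)
    by (simpl; f_equal; ring).
  apply is_lim_seq_scal_l, is_lim_seq_geom; rewrite Rabs_pos_eq; lra.
Qed.

Lemma ex_series_orbit h x :
  weight h -> 0 < x -> ex_series (fun k => orbit_prod h x (S k)).
Proof.
  intros Hh Hx; apply (ex_series_le (K := R_AbsRing) (V := R_CompleteNormedModule))
    with (majorant x); [|now apply ex_series_majorant].
  intros k; unfold norm; simpl; unfold abs; simpl.
  rewrite Rabs_pos_eq by (apply Rlt_le, orbit_prod_pos; easy).
  apply orbit_prod_le_majorant; [easy|lra].
Qed.

(** The variant that includes the empty product, needed for the recursion and for the half [k <= -1]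
    of the two-sided sums. *)
Lemma is_series_orbit0 h x :
  weight h -> 0 < x -> is_series (orbit_prod h x) (1 + orbit_sum h x).
Proof.
  intros Hh Hx; pose proof (Series_correct _ (ex_series_orbit h x Hh Hx)) as H.
  apply is_series_decr_1.
  match goal with |- is_series _ ?l => replace l with (orbit_sum h x) end; [easy|].
  unfold orbit_prod, plus, opp; simpl; ring.
Qed.

Lemma orbit_sum_rec h x :
  weight h -> 0 < x -> orbit_sum h x = h x * (1 + orbit_sum h (sfun x)).
Proof.
  intros Hh Hx.
  rewrite <- (is_series_unique _ _ (is_series_orbit0 h _ Hh (sfun_pos x Hx))).
  unfold orbit_sum; rewrite <- Series_scal_l; apply Series_ext; intros k.
  apply orbit_prod_shift.
Qed.

Lemma Series_ge0 (a : nat -> R) : (forall k, 0 <= a k) -> ex_series a -> 0 <= Series a.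
Proof.
  intros Ha Hex; replace 0 with (0 * Series a) by ring; rewrite <- Series_scal_l.
  apply Series_le; [|easy]; intros k; specialize (Ha k); lra.
Qed.

Lemma orbit_sum_ge0 h x : weight h -> 0 < x -> 0 <= orbit_sum h x.
Proof.
  intros Hh Hx; apply Series_ge0; [|now apply ex_series_orbit].
  intros k; apply Rlt_le, orbit_prod_pos; easy.
Qed.

(** The orbit stays below [/ 10], where [h y <= y * (2 + y) <= / 2], so a geometric series
    dominates. *)
Lemma orbit_sum_le1 h x : weight h -> 0 < x <= / 10 -> orbit_sum h x <= 1.
Proof.
  intros Hh Hx.
  assert (Hg : is_series (fun k => (/ 2) ^ S k) 1).
  { apply is_series_ext with (fun k => / 2 * (/ 2) ^ k); [easy|].
    replace 1 with (/ 2 * / (1 - / 2)) by field.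
    refine (is_series_scal (V := R_NormedModule) (/ 2) (fun k => (/ 2) ^ k)
              (/ (1 - / 2)) (is_series_geom (/ 2) _)).
    rewrite Rabs_pos_eq; lra. }
  rewrite <- (is_series_unique _ _ Hg); apply Series_le; [|now exists 1].
  intros k; split; [apply Rlt_le, orbit_prod_pos; easy|].
  unfold orbit_prod; generalize (S k); clear k; intros k.
  replace ((/ 2) ^ k) with (prodn (fun _ => / 2) k)
    by (induction k as [|k IH]; simpl; [easy|rewrite IH; ring]).
  apply prodn_le; intros i.
  pose proof (iter_sfun_pos x i (proj1 Hx)) as Hp.
  pose proof (iter_sfun_le x i (proj1 Hx)) as Hl.
  assert (x / 9 ^ i <= x).
  { assert (1 <= 9 ^ i) by (apply pow_R1_Rle; lra).
    apply Rmult_le_reg_r with (9 ^ i); [lra|].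
    replace (x / 9 ^ i * 9 ^ i) with x by (field; lra). nra. }
  pose proof (proj1 Hh _ Hp); split; [lra|]; nra.
Qed.

Lemma iter_sfun_continuity i x : 0 < x -> continuity_pt (Nat.iter i sfun) x.
Proof.
  intros Hx; induction i as [|i IH]; simpl.
  - apply continuity_pt_ex_derive; apply ex_derive_id.
  - apply (continuity_pt_comp (Nat.iter i sfun) sfun); [easy|].
    apply sfun_continuity, iter_sfun_pos, Hx.
Qed.

Lemma orbit_prod_continuity h k x :
  weight h -> 0 < x -> continuity_pt (fun y => orbit_prod h y k) x.
Proof.
  intros Hh Hx; unfold orbit_prod; induction k as [|k IH]; simpl.
  - apply continuity_pt_const; easy.
  - apply (continuity_pt_mult (fun y => prodn (fun i => h (Nat.iter i sfun y)) k)
             (fun y => h (Nat.iter k sfun y))); [easy|].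
    apply (continuity_pt_comp (Nat.iter k sfun) h); [now apply iter_sfun_continuity|].
    apply Hh, iter_sfun_pos, Hx.
Qed.

Lemma partial_sum_continuity h n x : weight h -> 0 < x ->
  continuity_pt (fun y => sum_f_R0 (fun k => orbit_prod h y (S k)) n) x.
Proof.
  intros Hh Hx; induction n as [|n IH]; simpl sum_f_R0.
  - now apply orbit_prod_continuity.
  - apply (continuity_pt_plus
      (fun y => sum_f_R0 (fun k => orbit_prod h y (S k)) n)
      (fun y => orbit_prod h y (S (S n)))); [easy|].
    now apply orbit_prod_continuity.
Qed.

(** The partial sums are continuous and converge uniformly on the ball of radius [x / 2] around [x],
    since their tails are dominated by the tail of [majorant (2 * x)]. *)
Lemma orbit_sum_continuity h x : weight h -> 0 < x -> continuity_pt (orbit_sum h) x.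
Proof.
  intros Hh Hx.
  assert (Hr : 0 < x / 2) by lra.
  apply CVU_continuity with
    (fn := fun n y => sum_f_R0 (fun k => orbit_prod h y (S k)) n)
    (x := x) (r := mkposreal _ Hr).
  - intros eps Heps.
    assert (HA := ex_series_majorant (2 * x) ltac:(lra)).
    pose proof (Series_correct _ HA) as Hs; apply is_series_Reals in Hs.
    destruct (Hs eps Heps) as [N HN]; exists N; intros n y Hn Hy.
    unfold Boule in Hy; simpl in Hy; apply Rabs_def2 in Hy.
    assert (Hy' : 0 < y <= 2 * x) by lra.
    specialize (HN n Hn); unfold Rdist in HN.
    pose proof (ex_series_orbit h y Hh (proj1 Hy')) as Ht.
    unfold orbit_sum.
    rewrite (Series_incr_n _ (S n) ltac:(lia) Ht).
    rewrite (Series_incr_n _ (S n) ltac:(lia) HA) in HN.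
    simpl pred in *; rewrite Rabs_minus_sym in HN.
    rewrite Rplus_minus_l in *.
    eapply Rle_lt_trans; [|apply HN].
    assert (Hle : 0 <= Series (fun k => orbit_prod h y (S (S n + k)))
              <= Series (fun k => majorant (2 * x) (S n + k))).
    { split.
      - apply Series_ge0.
        + intros k; apply Rlt_le, orbit_prod_pos; easy.
        + now apply -> (ex_series_incr_n (K := R_AbsRing)
            (fun k => orbit_prod h y (S k)) (S n)).
      - apply Series_le.
        + intros k; split; [apply Rlt_le, orbit_prod_pos; easy|].
          now apply orbit_prod_le_majorant.
        + now apply -> (ex_series_incr_n (K := R_AbsRing) (majorant (2 * x)) (S n)). }
    rewrite !Rabs_pos_eq; lra.
  - intros n y Hy; unfold Boule in Hy; simpl in Hy; apply Rabs_def2 in Hy.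
    apply partial_sum_continuity; [easy|lra].
  - unfold Boule; simpl; rewrite Rminus_diag, Rabs_R0; lra.
Qed.

(** * The margin as a quotient of two-sided series, and its symmetries *)

(** The series over all integers in closed form: the terms [k >= 0], the term [k = -1], and the
    terms [k <= -2] rewritten as a forward sum at [/ x]. *)
Definition csum (x : R) : R := orbit_sum cm1 x + 1 + orbit_sum dm1 (/ x).
Definition dsum (x : R) : R := orbit_sum dm1 x + 1 + orbit_sum cm1 (/ x).
Definition margin (x : R) : R := x * dsum x / csum x.

Lemma csum_pos x : 0 < x -> 0 < csum x.
Proof.
  intros Hx; pose proof (Rinv_0_lt_compat x Hx) as Hx'; unfold csum.
  pose proof (orbit_sum_ge0 cm1 x weight_cm1 Hx).
  pose proof (orbit_sum_ge0 dm1 _ weight_dm1 Hx'); lra.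
Qed.

Lemma dsum_inv x : dsum (/ x) = csum x.
Proof. unfold dsum, csum; rewrite Rinv_inv; ring. Qed.

Lemma csum_inv x : csum (/ x) = dsum x.
Proof. now rewrite <- (dsum_inv (/ x)), Rinv_inv. Qed.

Lemma dsum_pos x : 0 < x -> 0 < dsum x.
Proof. intros Hx; rewrite <- csum_inv; apply csum_pos, Rinv_0_lt_compat, Hx. Qed.

Lemma margin_pos x : 0 < x -> 0 < margin x.
Proof.
  intros Hx; apply Rdiv_lt_0_compat; [|now apply csum_pos].
  apply Rmult_lt_0_compat; [easy|now apply dsum_pos].
Qed.

Lemma margin_inv x : 0 < x -> margin (/ x) = / margin x.
Proof.
  intros Hx; unfold margin; rewrite dsum_inv, csum_inv.
  pose proof (csum_pos x Hx); pose proof (dsum_pos x Hx); field; lra.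
Qed.

(** Shifting the index by one divides every product by its factor at [x]. The forward sum is
    unrolled once at [x], the backward one at [/ sfun x], whose next orbit point is [/ x]. *)
Lemma csum_sfun x : 0 < x -> cm1 x * csum (sfun x) = csum x.
Proof.
  intros Hx; pose proof (cm1_pos x Hx) as Hc; pose proof (sfun_pos x Hx) as Hs.
  assert (Hx' := Rinv_0_lt_compat _ Hx); assert (Hs' := Rinv_0_lt_compat _ Hs).
  unfold csum; rewrite (orbit_sum_rec cm1 x weight_cm1 Hx).
  rewrite (orbit_sum_rec dm1 (/ sfun x) weight_dm1 Hs'), sfun_inv_sfun by easy.
  rewrite <- (dm1_inv_sfun x Hx); pose proof (dm1_pos _ Hs'); field; lra.
Qed.

Lemma dsum_sfun x : 0 < x -> dm1 x * dsum (sfun x) = dsum x.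
Proof.
  intros Hx; pose proof (dm1_pos x Hx) as Hc; pose proof (sfun_pos x Hx) as Hs.
  assert (Hx' := Rinv_0_lt_compat _ Hx); assert (Hs' := Rinv_0_lt_compat _ Hs).
  unfold dsum; rewrite (orbit_sum_rec dm1 x weight_dm1 Hx).
  rewrite (orbit_sum_rec cm1 (/ sfun x) weight_cm1 Hs'), sfun_inv_sfun by easy.
  rewrite <- (cm1_inv_sfun x Hx); pose proof (cm1_pos _ Hs'); field; lra.
Qed.

(** Compatibility of the recursions for [u], [v] and [x = v / u]; it cancels the factors produced by
    the shift. *)
Lemma sfun_cm1_dm1 x : 0 < x -> sfun x * cm1 x = x * dm1 x.
Proof.
  intros Hx; rewrite sfun_beta, cm1_beta, dm1_beta by easy.
  rewrite <- (beta_eq x Hx) at 5; pose proof (beta_pos x Hx); field; lra.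
Qed.

Lemma margin_sfun x : 0 < x -> margin (sfun x) = margin x.
Proof.
  intros Hx; pose proof (cm1_pos x Hx) as Hc; pose proof (dm1_pos x Hx) as Hd.
  pose proof (csum_pos _ (sfun_pos x Hx)).
  unfold margin; rewrite <- (csum_sfun x Hx), <- (dsum_sfun x Hx).
  replace (x * (dm1 x * dsum (sfun x))) with (x * dm1 x * dsum (sfun x)) by ring.
  rewrite <- sfun_cm1_dm1 by easy; field; lra.
Qed.

Lemma margin_continuity x : 0 < x -> continuity_pt margin x.
Proof.
  intros Hx; pose proof (Rinv_0_lt_compat x Hx) as Hx'.
  assert (Hi : continuity_pt Rinv x).
  { apply continuity_pt_ex_derive; auto_derive; lra. }
  assert (H : forall h1 h2, weight h1 -> weight h2 ->
    continuity_pt (fun y => orbit_sum h1 y + 1 + orbit_sum h2 (/ y)) x).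
  { intros h1 h2 H1 H2.
    apply (continuity_pt_plus (fun y => orbit_sum h1 y + 1)
             (fun y => orbit_sum h2 (/ y))).
    - apply (continuity_pt_plus (orbit_sum h1) (fun _ => 1)).
      + now apply orbit_sum_continuity.
      + now apply continuity_pt_const.
    - apply (continuity_pt_comp Rinv (orbit_sum h2)); [easy|].
      now apply orbit_sum_continuity. }
  apply (continuity_pt_div (fun y => y * dsum y) csum).
  - apply (continuity_pt_mult (fun y => y) dsum).
    + apply continuity_pt_ex_derive, ex_derive_id.
    + apply (H dm1 cm1); [apply weight_dm1|apply weight_cm1].
  - apply (H cm1 dm1); [apply weight_cm1|apply weight_dm1].
  - generalize (csum_pos x Hx); lra.
Qed.

(** * Reduction to a compact interval and the range of the margin *)

Lemma sfun_1 : sfun 1 = / 10.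
Proof.
  rewrite sfun_beta by lra.
  assert (H : beta 1 = / 2) by (rewrite <- (beta_unique (/ 2)) by lra; f_equal; field).
  rewrite H; field.
Qed.

Lemma beta_mono x y : 0 < x <= y -> beta x <= beta y.
Proof.
  intros H; pose proof (beta_pos x ltac:(lra)); pose proof (beta_pos y ltac:(lra)).
  apply quad_le; try lra; rewrite !beta_eq; lra.
Qed.

Lemma div_mono_cross a b c d : 0 < b -> 0 < d -> a * d <= c * b -> a / b <= c / d.
Proof.
  intros Hb Hd H; apply Rmult_le_reg_r with (b * d); [nra|].
  replace (a / b * (b * d)) with (a * d) by (field; lra).
  replace (c / d * (b * d)) with (c * b) by (field; lra). easy.
Qed.

Lemma sfun_mono x y : 0 < x <= y -> sfun x <= sfun y.
Proof.
  intros H; pose proof (beta_pos x ltac:(lra)); pose proof (beta_mono x y H).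
  rewrite !sfun_beta by lra; apply div_mono_cross; [lra|lra|].
  assert (beta x ^ 2 <= beta y ^ 2) by nra.
  assert (beta x * beta y * beta x <= beta x * beta y * beta y)
    by (apply Rmult_le_compat_l; nra).
  nra.
Qed.

(** Iterating [sfun] shrinks [x] by a factor of at least 9 until it first drops to 1 or below; by
    monotonicity a step from a point [>= 1] cannot land below [sfun 1 = / 10]. *)
Lemma margin_fundamental_ge1 x :
  1 <= x -> exists y, / 10 <= y <= 1 /\ margin y = margin x.
Proof.
  assert (Hn : forall n x, 1 <= x -> x <= 9 ^ n ->
    exists y, / 10 <= y <= 1 /\ margin y = margin x).
  { induction n as [|n IH]; intros z Hz Hzn.
    - simpl in Hzn; exists z; split; [lra|easy].
    - pose proof (sfun_le z ltac:(lra)) as Hl.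
      pose proof (sfun_mono 1 z ltac:(lra)) as Hm; rewrite sfun_1 in Hm.
      destruct (Rle_dec (sfun z) 1) as [H1|H1].
      + exists (sfun z); split; [lra|apply margin_sfun; lra].
      + destruct (IH (sfun z)) as [y [Hy Hy']]; [lra|simpl in Hzn; lra|].
        exists y; split; [easy|]; rewrite Hy'; apply margin_sfun; lra. }
  intros Hx; destruct (Pow_x_infinity 9 ltac:(rewrite Rabs_pos_eq; lra) x) as [n H].
  apply (Hn n); [easy|].
  specialize (H n (Nat.le_refl n)); rewrite Rabs_pos_eq in H; [lra|].
  apply pow_le; lra.
Qed.

Lemma margin_fundamental x :
  0 < x -> exists y, / 10 <= y <= 10 /\ margin y = margin x.
Proof.
  intros Hx; destruct (Rle_dec 1 x) as [H|H].
  - destruct (margin_fundamental_ge1 x H) as [y [Hy Hy']].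
    exists y; split; [lra|easy].
  - destruct (margin_fundamental_ge1 (/ x)) as [y [Hy Hy']].
    { rewrite <- Rinv_1; apply Rinv_le_contravar; lra. }
    exists (/ y); split.
    + assert (/ 1 <= / y <= / / 10) by (split; apply Rinv_le_contravar; lra).
      rewrite Rinv_inv in *; lra.
    + rewrite margin_inv, Hy', margin_inv, Rinv_inv by lra; easy.
Qed.

(** The minimum on [[/ 10, 10]] is global, inversion makes its reciprocal the maximum, attained at
    [/ x0], and the intermediate value theorem between [x0] and [/ x0] gives the rest. *)
Lemma margin_range :
  exists x0, 0 < x0 /\ (forall x, 0 < x -> margin x0 <= margin x <= / margin x0) /\
    forall y, margin x0 <= y <= / margin x0 -> exists x, 0 < x /\ margin x = y.
Proof.
  destruct (continuity_ab_min margin (/ 10) 10) as [x0 [Hmin Hx0]]; [lra| |].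
  { intros c Hc; apply margin_continuity; lra. }
  assert (Hge : forall x, 0 < x -> margin x0 <= margin x).
  { intros x Hx; destruct (margin_fundamental x Hx) as [y [Hy <-]]; now apply Hmin. }
  assert (Hp := margin_pos x0 ltac:(lra)).
  assert (Hx0' : 0 < / x0) by (apply Rinv_0_lt_compat; lra).
  exists x0; split; [lra|split].
  - intros x Hx; split; [now apply Hge|].
    rewrite <- (Rinv_inv (margin x)); apply Rinv_le_contravar; [easy|].
    rewrite <- margin_inv by easy; apply Hge, Rinv_0_lt_compat, Hx.
  - intros y Hy.
    destruct (Req_dec y (margin x0)) as [->|H1]; [exists x0; lra|].
    destruct (Req_dec y (/ margin x0)) as [->|H2].
    { exists (/ x0); split; [easy|apply margin_inv; lra]. }
    rewrite <- margin_inv in Hy, H2 by lra.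
    assert (Hc : forall z, 0 < z -> continuity_pt (fun x => margin x - y) z).
    { intros z Hz; apply (continuity_pt_minus margin (fun _ => y)).
      - now apply margin_continuity.
      - now apply continuity_pt_const. }
    (* The order of [x0] and [/ x0] is unknown. If they coincide, minimum and maximum agree and [y]
       is an endpoint value, already excluded; in the reversed order the sign is flipped to fit
       [IVT_interv]. *)
    destruct (Rtotal_order x0 (/ x0)) as [Hlt|[Heq|Hgt]].
    + destruct (IVT_interv (fun x => margin x - y) x0 (/ x0)) as [z [Hz Hz']]; try lra.
      * intros z Hz; apply Hc; lra.
      * exists z; split; lra.
    + rewrite <- Heq in Hy; lra.
    + destruct (IVT_interv (fun x => - (margin x - y)) (/ x0) x0) as [z [Hz Hz']];
        try lra.
      * intros z Hz; apply (continuity_pt_opp (fun x => margin x - y)); apply Hc; lra.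
      * exists z; split; lra.
Qed.

(** * Numerical bound on the minimum *)

(** Bounds on a whole ray or interval, because the iterates of [sfun] are only enclosed by
    rationals. *)
Definition sum_le (h : R -> R) (X K : R) : Prop :=
  forall y, 0 < y <= X -> orbit_sum h y <= K.
Definition sum_ge (h : R -> R) (X K : R) : Prop :=
  forall y, 0 < y -> X <= y -> K <= orbit_sum h y.

Lemma sfun_quad t : 0 < t -> sfun (t * (1 + 2 * t)) = t ^ 2 / (2 + t).
Proof. intros Ht; rewrite sfun_beta, beta_unique by nra; easy. Qed.

(** One turn of [orbit_sum_rec]: [t] bounds [beta] from above on the interval, and the monotone
    functions [h] and [sfun] are evaluated exactly at [t * (1 + 2 * t)]. *)
Lemma sum_le_step h t X' K' X K :
  weight h -> (forall x y, 0 < x <= y -> h x <= h y) ->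
  sum_le h X' K' -> 0 < t -> X <= t * (1 + 2 * t) -> t ^ 2 / (2 + t) <= X' ->
  0 <= K' -> h (t * (1 + 2 * t)) * (1 + K') <= K -> sum_le h X K.
Proof.
  intros Hh Hm Hs Ht HX HX' HK' HK y Hy.
  rewrite orbit_sum_rec by easy.
  assert (Hl : sfun y <= t ^ 2 / (2 + t))
    by (rewrite <- sfun_quad by easy; apply sfun_mono; lra).
  pose proof (sfun_pos y (proj1 Hy)); specialize (Hs (sfun y) ltac:(lra)).
  pose proof (orbit_sum_ge0 h (sfun y) Hh ltac:(lra)).
  pose proof (Hm y (t * (1 + 2 * t)) ltac:(lra)); pose proof (proj1 Hh y (proj1 Hy)).
  eapply Rle_trans; [|apply HK]; apply Rmult_le_compat; lra.
Qed.

Lemma sum_ge_step h t X' K' X K :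
  weight h -> (forall x y, 0 < x <= y -> h x <= h y) ->
  sum_ge h X' K' -> 0 < t -> t * (1 + 2 * t) <= X -> X' <= t ^ 2 / (2 + t) ->
  0 <= K' -> K <= h (t * (1 + 2 * t)) * (1 + K') -> sum_ge h X K.
Proof.
  intros Hh Hm Hs Ht HX HX' HK' HK y Hy0 Hy.
  assert (Hq : 0 < t * (1 + 2 * t)) by nra.
  rewrite orbit_sum_rec by (easy || lra).
  assert (Hl : t ^ 2 / (2 + t) <= sfun y)
    by (rewrite <- sfun_quad by easy; apply sfun_mono; lra).
  specialize (Hs (sfun y) (sfun_pos y Hy0) ltac:(lra)).
  pose proof (Hm (t * (1 + 2 * t)) y ltac:(lra)); pose proof (proj1 Hh _ Hq).
  eapply Rle_trans; [apply HK|]; apply Rmult_le_compat; lra.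
Qed.

Lemma cm1_mono x y : 0 < x <= y -> cm1 x <= cm1 y.
Proof.
  intros H; pose proof (beta_pos x ltac:(lra)); pose proof (beta_mono x y H).
  rewrite !cm1_beta; nra.
Qed.

Lemma dm1_mono x y : 0 < x <= y -> dm1 x <= dm1 y.
Proof.
  intros H; pose proof (beta_pos x ltac:(lra)); pose proof (beta_mono x y H).
  rewrite !dm1_beta by lra; apply div_mono_cross; [lra|lra|].
  assert (beta x ^ 2 <= beta y ^ 2) by nra.
  assert (beta x * beta y * beta x <= beta x * beta y * beta y)
    by (apply Rmult_le_compat_l; nra).
  nra.
Qed.

Lemma cm1_quad t : 0 < t -> cm1 (t * (1 + 2 * t)) = t * (2 + t).
Proof. intros Ht; rewrite cm1_beta, beta_unique by easy; easy. Qed.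

Lemma dm1_quad t : 0 < t -> dm1 (t * (1 + 2 * t)) = t ^ 2 / (1 + 2 * t).
Proof. intros Ht; rewrite dm1_beta, beta_unique by nra; easy. Qed.

Lemma sum_le_1 h X : weight h -> X <= / 10 -> sum_le h X 1.
Proof. intros Hh HX y Hy; apply orbit_sum_le1; [easy|lra]. Qed.

Lemma sum_ge_0 h X : weight h -> sum_ge h X 0.
Proof. intros Hh y Hy _; now apply orbit_sum_ge0. Qed.

(** Specialized to one weight with denominators cleared, so that for numerals [lra] settles every
    side condition. *)
Lemma cm1_le_step t X' K' X K :
  sum_le cm1 X' K' -> 0 < t -> X <= t * (1 + 2 * t) -> t ^ 2 <= X' * (2 + t) ->
  0 <= K' -> t * (2 + t) * (1 + K') <= K -> sum_le cm1 X K.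
Proof.
  intros; apply (sum_le_step cm1 t X' K'); auto using weight_cm1, cm1_mono.
  - apply Rle_div_l; lra.
  - now rewrite cm1_quad.
Qed.

Lemma dm1_le_step t X' K' X K :
  sum_le dm1 X' K' -> 0 < t -> X <= t * (1 + 2 * t) -> t ^ 2 <= X' * (2 + t) ->
  0 <= K' -> t ^ 2 * (1 + K') <= K * (1 + 2 * t) -> sum_le dm1 X K.
Proof.
  intros; apply (sum_le_step dm1 t X' K'); auto using weight_dm1, dm1_mono.
  - apply Rle_div_l; lra.
  - rewrite dm1_quad, Rmult_comm, Rmult_div_assoc by easy; apply Rle_div_l; lra.
Qed.

Lemma cm1_ge_step t X' K' X K :
  sum_ge cm1 X' K' -> 0 < t -> t * (1 + 2 * t) <= X -> X' * (2 + t) <= t ^ 2 ->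
  0 <= K' -> K <= t * (2 + t) * (1 + K') -> sum_ge cm1 X K.
Proof.
  intros; apply (sum_ge_step cm1 t X' K'); auto using weight_cm1, cm1_mono.
  - apply Rle_div_r; lra.
  - now rewrite cm1_quad.
Qed.

Lemma dm1_ge_step t X' K' X K :
  sum_ge dm1 X' K' -> 0 < t -> t * (1 + 2 * t) <= X -> X' * (2 + t) <= t ^ 2 ->
  0 <= K' -> K * (1 + 2 * t) <= t ^ 2 * (1 + K') -> sum_ge dm1 X K.
Proof.
  intros; apply (sum_ge_step dm1 t X' K'); auto using weight_dm1, dm1_mono.
  - apply Rle_div_r; lra.
  - rewrite dm1_quad, Rmult_comm, Rmult_div_assoc by easy; apply Rle_div_r; lra.
Qed.

(** The arguments are [t], [X'] and [K'] of the step lemma; [X] and [K] are read off the goal. *)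
Ltac cm1_le t X K := apply (cm1_le_step t X K); [|lra|lra|lra|lra|lra].
Ltac dm1_le t X K := apply (dm1_le_step t X K); [|lra|lra|lra|lra|lra].
Ltac cm1_ge t X K := apply (cm1_ge_step t X K); [|lra|lra|lra|lra|lra].
Ltac dm1_ge t X K := apply (dm1_ge_step t X K); [|lra|lra|lra|lra|lra].

(* The point [0.58] is close to the minimiser of [margin], whose minimum is about
   [0.9999032]; each step below moves one iterate of [sfun] along the orbit, with
   [t] a rounded value of [beta]. *)
Lemma dm1_sum_upper : sum_le dm1 (58 / 100) (7014900 / 100000000).
Proof.
  dm1_le (34371713 / 100000000) (5040774 / 100000000) (194973 / 100000000).
  dm1_le (4614842 / 100000000) (104083 / 100000000) (216 / 100000000).
  dm1_le (103870 / 100000000) (54 / 100000000) 1.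
  apply sum_le_1; [apply weight_dm1|lra].
Qed.

(** [100 / 58] is the reciprocal of the test point, where the backward half of the series is
    evaluated. *)
Lemma cm1_sum_upper : sum_le cm1 (100 / 58) (254009787 / 100000000).
Proof.
  cm1_le (71154512 / 100000000) (18671881 / 100000000) (31653124 / 100000000).
  cm1_le (14479036 / 100000000) (977450 / 100000000) (1927666 / 100000000).
  cm1_le (959057 / 100000000) (4578 / 100000000) (18321 / 100000000).
  cm1_le (4580 / 100000000) (1 / 100000000) 1.
  apply sum_le_1; [apply weight_cm1|lra].
Qed.

Lemma cm1_sum_lower : sum_ge cm1 (58 / 100) (88180130 / 100000000).
Proof.
  cm1_ge (34371709 / 100000000) (5040772 / 100000000) (9462264 / 100000000).
  cm1_ge (4614836 / 100000000) (104081 / 100000000) (207835 / 100000000).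
  cm1_ge (103864 / 100000000) (53 / 100000000) 0.
  apply sum_ge_0, weight_cm1.
Qed.

Lemma dm1_sum_lower : sum_ge dm1 (100 / 58) (21234365 / 100000000).
Proof.
  dm1_ge (71154508 / 100000000) (18671878 / 100000000) (1625809 / 100000000).
  dm1_ge (14479030 / 100000000) (977448 / 100000000) (9024 / 100000000).
  dm1_ge (959051 / 100000000) (4576 / 100000000) 0.
  apply sum_ge_0, weight_dm1.
Qed.

(** Upper bounds go into [dsum] and lower bounds into [csum]. After clearing the denominator the
    slack is below [10^-6], hence the eight decimals above. *)
Lemma margin_small : margin (58 / 100) <= 999904 / 1000000.
Proof.
  pose proof (dm1_sum_upper (58 / 100) ltac:(lra)) as H1.
  pose proof (cm1_sum_upper (/ (58 / 100)) ltac:(lra)) as H2.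
  pose proof (cm1_sum_lower (58 / 100) ltac:(lra) ltac:(lra)) as H3.
  pose proof (dm1_sum_lower (/ (58 / 100)) ltac:(lra) ltac:(lra)) as H4.
  unfold margin; apply Rle_div_l; [apply csum_pos; lra|].
  unfold csum, dsum; lra.
Qed.

(** * From ABMN solutions to orbits of [s], and their limits *)

Lemma ABMN_increments a b m n : positive_ABMN a b m n -> forall i,
  m i - m (i - 1)%Z = a i ^ 2 / b i /\ n (i - 1)%Z - n i = a i + 2 * b i /\
  m (i + 1)%Z - m i = 2 * a i + b i /\ n i - n (i + 1)%Z = b i ^ 2 / a i.
Proof.
  intros [H Hp] i; destruct (Hp i) as [Ha Hb].
  destruct (H i) as (_ & _ & E1 & E2 & E3 & E4); clear H Hp.
  set (A := a i) in *; set (B := b i) in *.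
  set (u := m i - m (i - 1)%Z); set (u' := m (i + 1)%Z - m i).
  set (v := n (i - 1)%Z - n i); set (v' := n i - n (i + 1)%Z).
  assert (F1 : (A + B) * A = A * u' - B * u) by (unfold u, u'; lra).
  assert (F2 : (A + B) * B = B * v - A * v') by (unfold v, v'; lra).
  assert (F3 : (A + B) ^ 2 = B * (u + u')) by (rewrite E3; unfold u, u'; ring).
  assert (F4 : (A + B) ^ 2 = A * (v + v')) by (rewrite E4; unfold v, v'; ring).
  clearbody u u' v v'.
  (* [A * F3 - B * F1] eliminates [u'] and leaves [(A + B) * A^2 = (A + B) * B * u]; likewise
     [B * F4 - A * F2] eliminates [v] below. *)
  assert (Hu : B * u = A ^ 2).
  { apply Rmult_eq_reg_l with (A + B); [|lra].
    assert (B * ((A + B) * A) = B * (A * u' - B * u)) by now rewrite F1.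
    assert (A * (A + B) ^ 2 = A * (B * (u + u'))) by now rewrite F3.
    lra. }
  assert (Hv : A * v' = B ^ 2).
  { apply Rmult_eq_reg_l with (A + B); [|lra].
    assert (A * ((A + B) * B) = A * (B * v - A * v')) by now rewrite F2.
    assert (B * (A + B) ^ 2 = B * (A * (v + v'))) by now rewrite F4.
    lra. }
  repeat split.
  - rewrite <- Hu; field; lra.
  - apply Rmult_eq_reg_l with A; lra.
  - apply Rmult_eq_reg_l with B; lra.
  - rewrite <- Hv; field; lra.
Qed.

Lemma ABMN_step a b m n : positive_ABMN a b m n -> forall i,
  let u j := m j - m (j - 1)%Z in
  let v j := n (j - 1)%Z - n j in
  0 < u i /\ 0 < v i /\
  v (i + 1)%Z / u (i + 1)%Z = sfun (v i / u i) /\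
  u (i + 1)%Z = u i * cm1 (v i / u i) /\ v (i + 1)%Z = v i * dm1 (v i / u i).
Proof.
  intros H i u v; destruct (proj2 H i) as [Ha Hb].
  destruct (ABMN_increments a b m n H i) as (Eu & Ev & Eu' & Ev').
  unfold u, v; replace (i + 1 - 1)%Z with i by ring.
  rewrite Eu, Ev, Eu', Ev'; set (A := a i) in *; set (B := b i) in *; clearbody A B.
  assert (Ht : 0 < B / A) by now apply Rdiv_lt_0_compat.
  (* The ratio [v / u] has parameter [t = B / A], so all claims become rational identities. *)
  replace ((A + 2 * B) / (A ^ 2 / B)) with (B / A * (1 + 2 * (B / A))) by (field; lra).
  rewrite sfun_quad, cm1_quad, dm1_quad by easy.
  repeat split; try (field; lra).
  - apply Rdiv_lt_0_compat; nra.
  - lra.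
Qed.

Lemma central_ratio_pos a b m n : positive_ABMN a b m n -> 0 < central_ratio m n.
Proof.
  intros H; destruct (ABMN_step a b m n H 0) as (Hu & Hv & _); simpl in *.
  now apply Rdiv_lt_0_compat.
Qed.

Lemma ABMN_forward a b m n x : positive_ABMN a b m n -> central_ratio m n = x ->
  forall k : nat,
  let K := Z.of_nat k in
  (n (K - 1)%Z - n K) / (m K - m (K - 1)%Z) = Nat.iter k sfun x /\
  m K - m (K - 1)%Z = (m 0%Z - m (-1)%Z) * orbit_prod cm1 x k /\
  n (K - 1)%Z - n K = (n (-1)%Z - n 0%Z) * orbit_prod dm1 x k.
Proof.
  intros H Hx; induction k as [|k IH]; intros K.
  - unfold K, orbit_prod; simpl; rewrite <- Hx; repeat split; ring.
  - destruct IH as (I1 & I2 & I3).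
    destruct (ABMN_step a b m n H (Z.of_nat k)) as (_ & _ & S1 & S2 & S3).
    replace K with (Z.of_nat k + 1)%Z by (unfold K; lia).
    rewrite S1, S2, S3, I1, I2, I3; unfold orbit_prod; simpl.
    repeat split; ring.
Qed.

Lemma lim_pinf_telescope (f : Z -> R) (q : nat -> R) A l :
  (forall k, f (Z.of_nat (S k)) - f (Z.of_nat k) = A * q k) -> is_series q l ->
  lim_pinf f (f 0%Z + A * l).
Proof.
  (* [sum_n q k] has [k + 1] terms and telescopes to the value of [f] at [k + 1], hence the
     shift. *)
  intros Hf Hq; apply is_lim_seq_Reals; apply is_lim_seq_incr_1.
  apply is_lim_seq_ext with (fun k => f 0%Z + A * sum_n q k).
  { induction n as [|n IH].
    - rewrite sum_O, <- Hf; simpl; ring.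
    - rewrite sum_Sn; unfold plus; simpl plus.
      change (f 0%Z + A * (sum_n q n + q (S n)) = f (Z.of_nat (S (S n)))).
      specialize (Hf (S n)); lra. }
  apply is_lim_seq_plus'; [apply is_lim_seq_const|].
  apply (is_lim_seq_scal_l _ A l); apply Hq.
Qed.

Lemma ABMN_lim_pinf a b m n : positive_ABMN a b m n ->
  let x := central_ratio m n in
  lim_pinf m (m 0%Z + (m 0%Z - m (-1)%Z) * orbit_sum cm1 x) /\
  lim_pinf n (n 0%Z - (n (-1)%Z - n 0%Z) * orbit_sum dm1 x).
Proof.
  intros H x; pose proof (central_ratio_pos a b m n H) as Hx; fold x in Hx.
  assert (Hpred : forall k, (Z.of_nat (S k) - 1)%Z = Z.of_nat k) by lia.
  split.
  - apply lim_pinf_telescope with (fun k => orbit_prod cm1 x (S k)).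
    + intros k; destruct (ABMN_forward a b m n x H eq_refl (S k)) as (_ & E & _).
      now rewrite Hpred in E.
    + apply Series_correct, ex_series_orbit; [apply weight_cm1|easy].
  - unfold Rminus; rewrite Ropp_mult_distr_l.
    apply lim_pinf_telescope with (fun k => orbit_prod dm1 x (S k)).
    + intros k; destruct (ABMN_forward a b m n x H eq_refl (S k)) as (_ & _ & E).
      rewrite Hpred in E; lra.
    + apply Series_correct, ex_series_orbit; [apply weight_dm1|easy].
Qed.

(** The reflection about [-1/2] swaps the indices [-1] and [0], so it exchanges the two central
    increments and inverts the central ratio; limits at minus infinity then come from those at plus
    infinity. *)
Lemma ABMN_reflect a b m n : positive_ABMN a b m n ->
  positive_ABMN (fun i => b (-1 - i)%Z) (fun i => a (-1 - i)%Z)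
                (fun i => n (-1 - i)%Z) (fun i => m (-1 - i)%Z).
Proof.
  intros [H Hp]; split; intros i.
  - destruct (H (-1 - i)%Z) as (H1 & H2 & E1 & E2 & E3 & E4).
    replace (-1 - i + 1)%Z with (-1 - (i - 1))%Z in * by ring.
    replace (-1 - i - 1)%Z with (-1 - (i + 1))%Z in * by ring.
    repeat split; lra.
  - split; apply Hp.
Qed.

Lemma lim_minf_reflect (f : Z -> R) l :
  lim_pinf (fun i => f (-1 - i)%Z) l -> lim_minf f l.
Proof.
  intros H; apply is_lim_seq_Reals, is_lim_seq_incr_1; apply is_lim_seq_Reals in H.
  apply is_lim_seq_ext with (2 := H); intros k; f_equal; lia.
Qed.

Lemma ABMN_lim_minf a b m n : positive_ABMN a b m n ->
  let x := central_ratio m n in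
  lim_minf m (m (-1)%Z - (m 0%Z - m (-1)%Z) * orbit_sum dm1 (/ x)) /\
  lim_minf n (n (-1)%Z + (n (-1)%Z - n 0%Z) * orbit_sum cm1 (/ x)).
Proof.
  intros H x; pose proof (ABMN_lim_pinf _ _ _ _ (ABMN_reflect a b m n H)) as [Hn Hm].
  assert (E : central_ratio (fun i => n (-1 - i)%Z) (fun i => m (-1 - i)%Z) = / x).
  { unfold x, central_ratio; simpl; symmetry; apply Rinv_div. }
  rewrite E in Hn, Hm; split; apply lim_minf_reflect; easy.
Qed.

Lemma ABMN_total_variation a b m n mmi mpi nmi npi : positive_ABMN a b m n ->
  lim_minf m mmi -> lim_pinf m mpi -> lim_minf n nmi -> lim_pinf n npi ->
  let x := central_ratio m n in
  mpi - mmi = (m 0%Z - m (-1)%Z) * csum x /\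
  nmi - npi = x * (m 0%Z - m (-1)%Z) * dsum x.
Proof.
  intros H Hm Hm' Hn Hn' x.
  destruct (ABMN_lim_pinf a b m n H) as [P1 P2].
  destruct (ABMN_lim_minf a b m n H) as [Q1 Q2].
  rewrite (UL_sequence _ _ _ Hm Q1), (UL_sequence _ _ _ Hm' P1),
    (UL_sequence _ _ _ Hn Q2), (UL_sequence _ _ _ Hn' P2).
  fold x; unfold csum, dsum; split; [ring|].
  destruct (ABMN_step a b m n H 0) as (Hu & _); simpl in Hu.
  replace (x * (m 0%Z - m (-1)%Z)) with (n (-1)%Z - n 0%Z)
    by (unfold x, central_ratio; field; lra).
  ring.
Qed.

(** Both total variations are proportional to [m 0 - m (-1)], which cancels. *)
Lemma mina_margin_eq a b m n mmi mpi nmi npi : positive_ABMN a b m n ->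
  lim_minf m mmi -> lim_pinf m mpi -> lim_minf n nmi -> lim_pinf n npi ->
  mina_margin mmi mpi nmi npi = margin (central_ratio m n).
Proof.
  intros H Hm Hm' Hn Hn'.
  destruct (ABMN_total_variation a b m n _ _ _ _ H Hm Hm' Hn Hn') as [E1 E2].
  unfold mina_margin; rewrite E1, E2; unfold margin.
  pose proof (csum_pos _ (central_ratio_pos a b m n H)).
  destruct (ABMN_step a b m n H 0) as (Hu & _); simpl in Hu.
  field; lra.
Qed.

(** * Construction of positive and standard solutions *)

(** Forward terms iterate [f], backward terms iterate [g]. The invariant [I] is there because [g] is
    a right inverse of [f] only on admissible states. *)
Lemma Z_orbit (A : Type) (f g : A -> A) (I : A -> Prop) (z : A) :
  I z -> (forall y, I y -> I (f y) /\ I (g y) /\ f (g y) = y) ->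
  exists U : Z -> A, U 0%Z = z /\ forall i, I (U i) /\ U (i + 1)%Z = f (U i).
Proof.
  intros Hz H.
  assert (If : forall k, I (Nat.iter k f z))
    by (induction k; simpl; [easy|now apply H]).
  assert (Ig : forall k, I (Nat.iter k g z))
    by (induction k; simpl; [easy|now apply H]).
  exists (fun i => if Z.leb 0 i then Nat.iter (Z.to_nat i) f z
                   else Nat.iter (Z.to_nat (- i)) g z).
  split; [easy|]; intros i; split; [destruct (Z.leb 0 i); easy|].
  destruct (Z.leb_spec 0 i) as [Hi|Hi].
  - rewrite (proj2 (Z.leb_le 0 (i + 1))) by lia.
    now replace (Z.to_nat (i + 1)) with (S (Z.to_nat i)) by lia.
  - replace (Z.to_nat (- i)) with (S (Z.to_nat (- (i + 1)))) by lia; simpl.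
    rewrite (proj2 (proj2 (H _ (Ig _)))).
    (* The two branches meet at [i = -1], where both give [z]. *)
    destruct (Z.leb_spec 0 (i + 1)) as [Hi'|Hi']; [|easy].
    now replace (i + 1)%Z with 0%Z by lia.
Qed.

Lemma positive_ABMN_exists x u0 m0 n0 : 0 < x -> 0 < u0 ->
  exists a b m n, positive_ABMN a b m n /\ m 0%Z = m0 /\ n 0%Z = n0 /\
    m 0%Z - m (-1)%Z = u0 /\ n (-1)%Z - n 0%Z = x * u0.
Proof.
  intros Hx Hu0.
  (* A state is [(x_i, u_i, m_i, n_i)] with [u_i = m_i - m_(i-1)] and
     [x_i u_i = n_(i-1) - n_i]. *)
  destruct (Z_orbit (R * R * R * R)
    (fun '(x, u, m, n) =>
       (sfun x, u * cm1 x, m + u * cm1 x, n - sfun x * (u * cm1 x)))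
    (fun '(x, u, m, n) => (sm1 x, u / cm1 (sm1 x), m - u, n + x * u))
    (fun '(x, u, m, n) => 0 < x /\ 0 < u) (x, u0, m0, n0)) as [U [HU0 HU]].
  { easy. }
  { intros [[[y u] m] n] [Hy Hu].
    pose proof (cm1_pos y Hy); pose proof (cm1_pos _ (sm1_pos y Hy)).
    repeat split.
    - now apply sfun_pos.
    - now apply Rmult_lt_0_compat.
    - now apply sm1_pos.
    - now apply Rdiv_lt_0_compat.
    - rewrite sfun_sm1 by easy; repeat apply f_equal2; field; lra. }
  set (X := fun i => fst (fst (fst (U i)))); set (V := fun i => snd (fst (fst (U i)))).
  set (m := fun i => snd (fst (U i))); set (n := fun i => snd (U i)).
  assert (HX : forall i, 0 < X i /\ 0 < V i).
  { intros i; destruct (HU i) as [H _]; unfold X, V; now destruct (U i) as [[[]]]. }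
  assert (Hs : forall i, X (i + 1)%Z = sfun (X i) /\ V (i + 1)%Z = V i * cm1 (X i) /\
    m (i + 1)%Z = m i + V i * cm1 (X i) /\
    n (i + 1)%Z = n i - sfun (X i) * (V i * cm1 (X i))).
  { intros i; destruct (HU i) as [_ H]; unfold X, V, m, n; rewrite H.
    now destruct (U i) as [[[]]]. }
  assert (Hd : forall i, m i - m (i - 1)%Z = V i /\ n (i - 1)%Z - n i = X i * V i).
  { intros i; destruct (Hs (i - 1)%Z) as (E1 & E2 & E3 & E4).
    replace (i - 1 + 1)%Z with i in * by ring; rewrite E1, E2, E3, E4; split; ring. }
  (* Solving [u = a^2 / b] and [t = b / a] gives [a = t * u] and [b = t^2 * u]. *)
  exists (fun i => beta (X i) * V i), (fun i => beta (X i) ^ 2 * V i), m, n.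
  assert (Hpos : forall i, 0 < beta (X i) * V i /\ 0 < beta (X i) ^ 2 * V i).
  { intros i; destruct (HX i) as [H1 H2]; pose proof (beta_pos _ H1).
    split; apply Rmult_lt_0_compat; nra. }
  split; [split; [|easy]|].
  - intros i; destruct (HX i) as [H1 H2]; pose proof (beta_pos _ H1) as Hb.
    destruct (Hs i) as (_ & _ & E3 & E4); destruct (Hd i) as [D1 D2].
    replace (m (i - 1)%Z) with (m i - V i) by lra.
    replace (n (i - 1)%Z) with (n i + X i * V i) by lra.
    rewrite E3, E4, sfun_beta, cm1_beta by easy.
    destruct (Hpos i); pose proof (beta_eq (X i) H1) as He.
    set (t := beta (X i)) in *; clearbody t; rewrite <- He.
    repeat split; try lra; field; lra.
  - destruct (Hd 0%Z) as [D1 D2]; simpl in D1, D2; rewrite D1, D2.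
    unfold X, V, m, n; rewrite HU0; easy.
Qed.

Lemma standard_exists x : 0 < x ->
  exists a b m n, standard a b m n /\ central_ratio m n = x /\ lim_minf n (margin x).
Proof.
  intros Hx; pose proof (csum_pos x Hx) as Hc.
  assert (Hu : 0 < / csum x) by now apply Rinv_0_lt_compat.
  assert (Huc : / csum x * csum x = 1) by (field; lra).
  remember (/ csum x) as u eqn:Eu0.
  (* The increment [u = / csum x] makes the total variation of [m] equal to 1; the values at 0 are
     chosen so that [m] tends to 0 at minus infinity and [n] tends to 0 at plus infinity. *)
  destruct (positive_ABMN_exists x u (u * (1 + orbit_sum dm1 (/ x)))
    (x * u * orbit_sum dm1 x) Hx Hu) as (a & b & m & n & H & Em & En & Eu & Ev).
  assert (Ex : central_ratio m n = x)
    by (unfold central_ratio; rewrite Eu, Ev; field; lra).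
  destruct (ABMN_lim_pinf a b m n H) as [P1 P2].
  destruct (ABMN_lim_minf a b m n H) as [Q1 Q2].
  rewrite Ex in P1, P2, Q1, Q2; rewrite Eu in P1, Q1; rewrite Ev in P2, Q2.
  replace (m (-1)%Z) with (m 0%Z - u) in Q1 by lra.
  replace (n (-1)%Z) with (n 0%Z + x * u) in Q2 by lra.
  rewrite Em in P1, Q1; rewrite En in P2, Q2.
  assert (Hn : lim_minf n (margin x)).
  { refine (eq_ind _ (lim_minf n) Q2 _ _).
    unfold margin, Rdiv; rewrite <- Eu0; unfold dsum; ring. }
  exists a, b, m, n; split; [|easy].
  split; [easy|]; repeat split.
  - refine (eq_ind _ (lim_minf m) Q1 _ _); ring.
  - refine (eq_ind _ (lim_pinf n) P2 _ _); ring.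
  - refine (eq_ind _ (lim_pinf m) P1 _ _).
    transitivity (u * csum x); [unfold csum; ring|easy].
  - now exists (margin x).
Qed.

(** * Identification of the Mina margin map and of the two-sided sums *)

(** Existence gives the specification of [epsilon]; whichever standard solution it yields, the
    central ratio alone fixes its margin, and this margin is its limit of [n] at minus infinity. *)
Lemma MinaMap_eq x : 0 < x -> MinaMap x = margin x.
Proof.
  intros Hx; unfold MinaMap.
  match goal with |- epsilon ?i ?P = _ => pose proof (epsilon_spec i P) as H end.
  destruct H as (a & b & m & n & (H & Hm & Hn & Hm' & _) & Ex & Hn').
  { destruct (standard_exists x Hx) as (a & b & m & n & H).
    now exists (margin x), a, b, m, n. }
  pose proof (mina_margin_eq a b m n _ _ _ _ H Hm Hm' Hn' Hn) as E.
  rewrite Ex in E; rewrite <- E.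
  unfold mina_margin; field.
Qed.

Lemma margins_of_positive_iff r :
  margins_of_positive r <-> exists x, 0 < x /\ margin x = r.
Proof.
  split.
  - intros (a & b & m & n & mmi & mpi & nmi & npi & H & Hm & Hm' & Hn & Hn' & ->).
    exists (central_ratio m n); split; [now apply (central_ratio_pos a b)|].
    symmetry; now apply (mina_margin_eq a b).
  - intros (x & Hx & <-).
    destruct (standard_exists x Hx) as
      (a & b & m & n & (H & Hm & Hn & Hm' & _) & Ex & Hn').
    exists a, b, m, n, 0, 1, (margin x), 0; repeat (split; [easy|]).
    unfold mina_margin; field.
Qed.

Lemma s_Z_of_nat k x : s_Z (Z.of_nat k) x = Nat.iter k sfun x.
Proof.
  destruct k as [|k]; [easy|]; simpl s_Z; now rewrite SuccNat2Pos.id_succ.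
Qed.

(** [sm1] is [sfun] conjugated by inversion, so the inner reciprocals cancel. *)
Lemma s_Z_neg k x : s_Z (- Z.of_nat k - 1) x = / sfun (Nat.iter k sfun (/ x)).
Proof.
  replace (- Z.of_nat k - 1)%Z with (- Z.of_nat (S k))%Z by lia; simpl s_Z.
  rewrite SuccNat2Pos.id_succ; simpl; unfold sm1 at 1; do 2 f_equal.
  induction k as [|k IH]; simpl; [easy|].
  unfold sm1 at 1; now rewrite Rinv_inv, IH.
Qed.

(* The reciprocals in the product convention for [k <= -2] turn the backward orbit
   of [x] into the forward orbit of [/ x], with [cm1] and [dm1] exchanged. *)
Lemma zsum_orbit h h' x : weight h -> weight h' ->
  (forall y, 0 < y -> / h (/ sfun y) = h' y) -> 0 < x ->
  zsum (fun k => zprod (fun i => h (s_Z i x)) k)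
       (orbit_sum h x + 1 + orbit_sum h' (/ x)).
Proof.
  intros Hh Hh' Hinv Hx; pose proof (Rinv_0_lt_compat x Hx) as Hx'.
  (* The empty product at [k = -1] falls into the negative half, so the summand 1 goes there. *)
  exists (orbit_sum h x), (1 + orbit_sum h' (/ x)); split; [|split; [|ring]].
  - apply is_series_Reals.
    eapply is_series_ext; [|apply Series_correct, ex_series_orbit; [apply Hh|easy]].
    intros k; unfold zprod; rewrite (proj2 (Z.leb_le 0 _)) by lia.
    rewrite Nat2Z.id; apply prodn_ext; intros i; now rewrite s_Z_of_nat.
  - apply is_series_Reals.
    eapply is_series_ext; [|now apply is_series_orbit0].
    intros k; unfold zprod; rewrite (proj2 (Z.leb_gt 0 _)) by lia.
    replace (Z.to_nat (- (- Z.of_nat k - 1) - 1)) with k by lia.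
    apply prodn_ext; intros i; rewrite s_Z_neg, Hinv; [easy|].
    now apply iter_sfun_pos.
Qed.

Theorem mainTheorem14 :
  (forall x, 0 < x -> 0 < MinaMap x) /\
  (forall x, 0 < x -> MinaMap (sfun x) = MinaMap x) /\
  (forall x, 0 < x -> continuity_pt MinaMap x) /\
  (forall x, 0 < x ->
     exists Sc Sd,
       zsum (fun k => zprod (fun i => c_Z i x - 1) k) Sc /\
       zsum (fun k => zprod (fun i => d_Z i x - 1) k) Sd /\
       MinaMap x = / Sc * (x * Sd)) /\
  (exists lam, 0 < lam /\ lam <= 999904 / 1000000 /\
     is_inf margins_of_positive lam /\
     forall y, (exists x, 0 < x /\ MinaMap x = y) <-> (lam <= y <= / lam)).
Proof.
  split; [|split; [|split; [|split]]].
  - intros x Hx; rewrite MinaMap_eq by easy; now apply margin_pos.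
  - intros x Hx; rewrite !MinaMap_eq by (easy || now apply sfun_pos).
    now apply margin_sfun.
  - intros x Hx; apply continuity_pt_filterlim.
    (* [MinaMap] is known to agree with [margin] only at positive arguments; the ball of radius [x]
       stays among them. *)
    apply continuous_ext_loc with (g := margin).
    + exists (mkposreal x Hx); intros y Hy; symmetry; apply MinaMap_eq.
      unfold ball in Hy; simpl in Hy; unfold AbsRing_ball, abs, minus, plus, opp in Hy.
      simpl in Hy; apply Rabs_def2 in Hy; lra.
    + apply continuity_pt_filterlim; now apply margin_continuity.
  - intros x Hx; exists (csum x), (dsum x); split; [|split].
    + apply (zsum_orbit cm1 dm1); auto using weight_cm1, weight_dm1, cm1_inv_sfun.
    + apply (zsum_orbit dm1 cm1); auto using weight_cm1, weight_dm1, dm1_inv_sfun.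
    + rewrite MinaMap_eq by easy; unfold margin, Rdiv; ring.
  - destruct margin_range as (x0 & Hx0 & Hb & Hs); exists (margin x0).
    split; [now apply margin_pos|split; [|split; [split|]]].
    + eapply Rle_trans; [apply (Hb (58 / 100)); lra|apply margin_small].
    + intros y Hy; apply margins_of_positive_iff in Hy as (x & Hx & <-); now apply Hb.
    + intros l Hl; apply Hl, margins_of_positive_iff; now exists x0.
    + intros y; split.
      * intros (x & Hx & <-); rewrite MinaMap_eq by easy; now apply Hb.
      * intros Hy; destruct (Hs y Hy) as (x & Hx & <-); exists x.
        split; [easy|now apply MinaMap_eq].
Qed.
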